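(* Let $q=4k$, where $k=2^{\ell}$ for some integer $\ell\ge 2$, and let $G=\langle a,b\rangle\le\mathfrak{S}_q$ be the group described in the context. Let $f_2$ be a permutation group polynomial over $\mathbb{F}_q$ corresponding to $G$, with permutation polynomial tuple $\underline{\beta}_{f_2}=(\beta_0,\beta_1,\ldots,\beta_{q-1})\in\mathfrak{S}_q^q$. Then there are $q!$ permutation group polynomials equivalent to $f_2$.
   Context: $\mathfrak{S}_q$ is the symmetric group on $\mathbb{F}_q=\{c_0,\ldots,c_{q-1}\}$ (a fixed enumeration); permutations are composed right to left. The permutations are $a=(c_0,c_1)(c_2,c_3)\cdots(c_{4k-2},c_{4k-1})$ and $$\begin{aligned}b=&(c_0,c_{2k-2},\ldots,c_{2n_1},c_{2(2n_1+k-1)},\ldots,c_{k-2},c_{4k-6},\;c_k,c_{2k},\ldots,c_{2n_2+k},c_{2(2n_2+k)},\ldots,c_{2k-4},c_{4k-8},\;c_{4k-1},c_{4k-4})\\&(c_1,c_{2k+1},\ldots,c_{2n_1+1},c_{2(2n_1+k)+1},\ldots,c_{k-1},c_{4k-3},\;c_{k+1},c_{2k-1},\ldots,c_{2n_2+k+1},c_{2(2n_2+k)-1},\ldots,c_{2k-3},c_{4k-9},\;c_{4k-2},c_{4k-5}),\end{aligned}$$ where in each of the two cycles (of length $2k$) $n_1$ runs over $0,1,\ldots,\frac{k-2}{2}$ and $n_2$ runs over $0,1,\ldots,\frac{k-4}{2}$. It is known that $|a|=2$, $|b|=2k$, $ab=b^{k+1}a$, that $G=\langle a,b\rangle=\{b^ja^i: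 0\le j\le \frac q2-1,\ 0\le i\le 1\}$ has order $q$, and that no non-identity element of $G$ has a fixed point. Functions $\mathbb{F}_q^2\to\mathbb{F}_q$ are identified with polynomials in $\mathbb{F}_q[X_1,X_2]$ of degree less than $q$ in each variable (these are the polynomials being counted). A bivariate polynomial $f$ is a local permutation polynomial (LPP) if for every $c\in\mathbb{F}_q$ both $x\mapsto f(x,c)$ and $x\mapsto f(c,x)$ are bijections of $\mathbb{F}_q$. Bivariate LPPs are in bijection with permutation polynomial tuples, i.e. tuples $\underline{\beta}_f=(\beta_0,\ldots,\beta_{q-1})\in\mathfrak{S}_q^q$ such that $\beta_i\beta_j^{-1}$ has no fixed point for $i\ne j$, via $f(x,\beta_i(x))=c_i$ for all $x\in\mathbb{F}_q$ and all $i$. An LPP is a permutation group polynomial if the entries of its tuple form a subgroup of $\mathfrak{S}_q$, and it then corresponds to that subgroup. Two LPPs $f,g$ with tuples $(\beta_0,\ldots,\beta_{q-1})$ and $(\gamma_0,\ldots,\gamma_{q-1})$ are equivalent if there exist $\lambda,\sigma\in\mathfrak{S}_q$ with $\lambda\beta_i\sigma=\gamma_i$ for all $0\le i\le q-1$. *)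

(* Defs.v *)
From HB Require Import structures.
From mathcomp Require Import all_boot all_order all_fingroup all_algebra.
From mathcomp Require Import mpoly.

Set Implicit Arguments.
Unset Strict Implicit.
Unset Printing Implicit Defensive.

Import GRing.Theory.
Local Open Scope ring_scope.

(* The cycle (s_0, s_1, ..., s_(m-1)) as a permutation.  It is only meant for
   duplicate-free s; undup makes the definition total. *)
Definition cycle_perm (T : finType) (s : seq T) : {perm T} :=
  perm (can_inj (prev_next (undup_uniq s))).

(* Subscripts occurring in the two cycles of b, in order. *)
Definition b_subscripts1 (k : nat) : seq nat :=
  (flatten [seq [:: 2 * n1; 2 * (2 * n1 + k - 1)] | n1 <- iota 0 ((k - 2) %/ 2).+1]
   ++ flatten [seq [:: 2 * n2 + k; 2 * (2 * n2 + k)] | n2 <- iota 0 ((k - 4) %/ 2).+1]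
   ++ [:: 4 * k - 1; 4 * k - 4])%N.

Definition b_subscripts2 (k : nat) : seq nat :=
  (flatten [seq [:: 2 * n1 + 1; 2 * (2 * n1 + k) + 1] | n1 <- iota 0 ((k - 2) %/ 2).+1]
   ++ flatten [seq [:: 2 * n2 + k + 1; 2 * (2 * n2 + k) - 1] | n2 <- iota 0 ((k - 4) %/ 2).+1]
   ++ [:: 4 * k - 2; 4 * k - 5])%N.

Section LocalPermutationPolynomials.

Variable F : finFieldType.

(* In the next three definitions c lists the elements c_0, ..., c_(4k-1) of F.
   Products of permutations in MathComp compose left to right; the factors
   below are disjoint, so the order is immaterial here, and so is it for the
   generated subgroup. *)
Definition perm_a (k : nat) (c : seq F) : {perm F} :=
  (\prod_(i < 2 * k) cycle_perm (T := F) [:: c`_(2 * i)%N; c`_(2 * i + 1)%N]%R)%g.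

Definition perm_b (k : nat) (c : seq F) : {perm F} :=
  (cycle_perm (T := F) [seq c`_i | i <- b_subscripts1 k]%R
   * cycle_perm (T := F) [seq c`_i | i <- b_subscripts2 k]%R)%g.

Definition group_G (k : nat) (c : seq F) : {group {perm F}} :=
  <<[set perm_a k c; perm_b k c]>>%G.

Definition eval2 (f : {mpoly F[2]}) (x y : F) : F :=
  f.@[tnth [tuple x; y]].

(* Degree less than #|F| in each variable: these polynomials are the canonical
   representatives of the functions F * F -> F. *)
Definition reduced (f : {mpoly F[2]}) : Prop :=
  forall m : 'X_{1..2}, m \in msupp f -> forall i : 'I_2, (m i < #|F|)%N.

Definition is_LPP (f : {mpoly F[2]}) : Prop :=
  reduced f /\
  forall z : F, bijective (fun x => eval2 f x z) /\
                bijective (fun x => eval2 f z x).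

Definition perm_poly_tuple (q : nat) (beta : q.-tuple {perm F}) : Prop :=
  forall i j : 'I_q, i != j ->
  forall x : F, tnth beta i (((tnth beta j)^-1)%g x) != x.

(* beta is the permutation polynomial tuple of f, for the enumeration c. *)
Definition tuple_of_LPP (q : nat) (c : q.-tuple F) (f : {mpoly F[2]})
    (beta : q.-tuple {perm F}) : Prop :=
  perm_poly_tuple beta /\
  forall (i : 'I_q) (x : F), eval2 f x (tnth beta i x) = tnth c i.

Definition group_poly_for (q : nat) (c : q.-tuple F) (f : {mpoly F[2]})
    (H : {group {perm F}}) : Prop :=
  is_LPP f /\
  exists2 beta : q.-tuple {perm F},
    tuple_of_LPP c f beta & [set tnth beta i | i : 'I_q] = H.

Definition permutation_group_polynomial (q : nat) (c : q.-tuple F)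
    (f : {mpoly F[2]}) : Prop :=
  exists H : {group {perm F}}, group_poly_for c f H.

Definition LPP_equivalent (q : nat) (c : q.-tuple F) (f g : {mpoly F[2]}) : Prop :=
  exists beta gamma : q.-tuple {perm F},
    [/\ tuple_of_LPP c f beta, tuple_of_LPP c g gamma
      & exists lambda sigma : {perm F},
          forall (i : 'I_q) (x : F),
            lambda (tnth beta i (sigma x)) = tnth gamma i x].

End LocalPermutationPolynomials.

(* Exactly n elements of T satisfy P. *)
Definition has_cardinal (T : eqType) (P : T -> Prop) (n : nat) : Prop :=
  exists s : seq T, [/\ uniq s, size s = n & forall x : T, x \in s <-> P x].

(* Main.v *)
Require Import Defs.
From mathcomp Require Import all_boot all_order all_fingroup all_algebra.
From mathcomp Require Import mpoly.

(** As the set of entries of the permutation polynomial tuple [beta], the group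
    [G] is regular on the field.  If [lambda beta_i sigma] lists a group then
    [sigma = h lambda^-1] with [h] in [G], so the tuples to be counted are the
    [lambda beta_i h lambda^-1].  Fix a point [o].  Since [G] has a regular
    centralizer, [lambda] may be changed so that [h^-1 o = lambda^-1 o]; then
    [h] is a function of [lambda], and as the [i]-th entry maps [o] to
    [lambda (beta_i o)], the tuple determines [lambda]. *)

Set Implicit Arguments.
Unset Strict Implicit.
Unset Printing Implicit Defensive.

Import GRing.Theory.

(** * Polynomials of degree less than [q] in each variable as functions of two variables *)

Section Interpolation.

Local Open Scope ring_scope.

Variable F : finFieldType.

(** Keeping the coefficients in a matrix turns evaluation at all pairs into a matrix product. *)
Definition grid_mpoly (q : nat) (A : 'M[F]_q) : {mpoly F[2]} :=
  \sum_(i < q) \sum_(j < q) A i j *: 'X_[[multinom [tuple (i : nat); (j : nat)]]].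

Lemma mcoeff_grid_mpoly q (A : 'M[F]_q) (m : 'X_{1..2}) :
  (grid_mpoly A)@_m =
  \sum_(i < q) \sum_(j < q) A i j * ((m 0 == i) && (m 1 == j))%:R.
Proof.
rewrite raddf_sum; apply: eq_bigr => i _.
rewrite raddf_sum; apply: eq_bigr => j _ /=.
rewrite mcoeffZ mcoeffX; congr (_ * (_ : bool)%:R).
apply/eqP/andP => [<-|[/eqP mi /eqP mj]]; first by rewrite !multinomE !(tnth_nth 0%N).
apply/mnmP => t; rewrite multinomE (tnth_nth 0%N).
case: t => [[|[|//]] lt] /=; rewrite -?mi -?mj; congr (m _); exact: val_inj.
Qed.

Lemma grid_mpoly_reduced q (A : 'M[F]_q) : #|F| = q -> reduced (grid_mpoly A).
Proof.
move=> cardF m; rewrite mcoeff_msupp mcoeff_grid_mpoly cardF => nz.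
have [/andP[lt0 lt1] | ge] := boolP ((m 0%R < q) && (m 1%R < q))%N.
  move=> t; have [->|->] // : t = 0 \/ t = 1.
  by case: t => [[|[|//]] lt]; [left | right]; apply: val_inj.
case/eqP: nz; apply: big1 => i _; apply: big1 => j _.
case: andP => [[/eqP mi /eqP mj]|]; last by rewrite mulr0.
by rewrite mi mj !ltn_ord in ge.
Qed.

Lemma reduced_grid_mpoly q (f : {mpoly F[2]}) : #|F| = q -> reduced f ->
  f = grid_mpoly (\matrix_(i < q, j < q)
                    f@_[multinom [tuple (i : nat); (j : nat)]]).
Proof.
move=> cardF redf; apply/mpolyP => m; rewrite mcoeff_grid_mpoly.
have [/andP[lt0 lt1] | ge] := boolP ((m 0%R < q) && (m 1%R < q))%N.
  rewrite (bigD1 (Ordinal lt0)) //= (bigD1 (Ordinal lt1)) //=.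
  rewrite [m 0 == _]eqxx [m 1 == _]eqxx mulr1 mxE.
  rewrite [X in _ + X + _]big1 => [|j ne]; last first.
    by rewrite [m 1 == _]eq_sym (negPf (ne : val j != _)) mulr0.
  rewrite big1 => [|i ne]; last first.
    rewrite big1 // => j _.
    by rewrite [m 0 == _]eq_sym (negPf (ne : val i != _)) mulr0.
  rewrite !addr0; congr (_@__); apply/mnmP => t; rewrite multinomE (tnth_nth 0%N).
  case: t => [[|[|//]] lt] /=; congr (m _); exact: val_inj.
rewrite memN_msupp_eq0.
  rewrite big1 // => i _; rewrite big1 // => j _.
  case: andP => [[/eqP mi /eqP mj]|]; last by rewrite mulr0.
  by rewrite mi mj !ltn_ord in ge.
by apply: contra ge => /redf lt; rewrite -cardF !lt.
Qed.

(** Column [j] of [V] lists the powers of [c_j], so the value is the bilinear form of [A] at columns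
    [i] and [j]. *)
Lemma eval2_grid_mpoly q (c : q.-tuple F) (A : 'M[F]_q) (i j : 'I_q) :
  let V := Vandermonde q (\row_(t < q) tnth c t) in
  eval2 (grid_mpoly A) (tnth c i) (tnth c j) = (V^T *m A *m V) i j.
Proof.
rewrite /eval2 /grid_mpoly raddf_sum mxE.
under [RHS]eq_bigr do rewrite mxE mulr_suml.
rewrite exchange_big; apply: eq_bigr => s _.
rewrite raddf_sum; apply: eq_bigr => t _ /=.
rewrite mevalZ mevalX !big_ord_recl big_ord0 !multinomE !(tnth_nth 0) /= !mxE.
by rewrite mulr1 !(tnth_nth 0) mulrCA mulrA.
Qed.

Section FullEnumeration.

Variables (q : nat) (c : q.-tuple F).
Hypotheses (cardF : #|F| = q) (uniq_c : uniq c).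

Lemma tnth_enumeration_inj : injective (tnth c).
Proof. by apply/tuple_uniqP. Qed.

Lemma tnth_enumeration_surj (x : F) : exists i, tnth c i = x.
Proof.
have [|g _ gK] := inj_card_bij tnth_enumeration_inj; first by rewrite card_ord cardF.
by exists (g x).
Qed.

Lemma Vandermonde_enumeration_unit :
  Vandermonde q (\row_(t < q) tnth c t) \in unitmx.
Proof.
rewrite unitmxE det_Vandermonde unitfE.
apply/prodf_neq0 => i _; apply/prodf_neq0 => j lt_ij.
rewrite !mxE subr_eq0 (inj_eq tnth_enumeration_inj).
by apply: contraL lt_ij => /eqP->; rewrite ltnn.
Qed.

Lemma reduced_interpolation (phi : F -> F -> F) :
  exists2 f, reduced f & forall x y, eval2 f x y = phi x y.
Proof.
set V := Vandermonde q (\row_(t < q) tnth c t).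
have uV : V \in unitmx := Vandermonde_enumeration_unit.
pose M := \matrix_(i < q, j < q) phi (tnth c i) (tnth c j).
(* This coefficient matrix is the solution [A] of [V^T *m A *m V = M], where [M] is the table of
   values. *)
exists (grid_mpoly (invmx V^T *m M *m invmx V)).
  exact: grid_mpoly_reduced.
move=> x y; have [i <-] := tnth_enumeration_surj x.
have [j <-] := tnth_enumeration_surj y.
rewrite eval2_grid_mpoly -/V !mulmxA mulmxV ?unitmx_tr // mul1mx mulmxKV //.
by rewrite mxE.
Qed.

Lemma reduced_eval2_inj (f g : {mpoly F[2]}) : reduced f -> reduced g ->
  (forall x y, eval2 f x y = eval2 g x y) -> f = g.
Proof.
move=> /(reduced_grid_mpoly cardF)-> /(reduced_grid_mpoly cardF)->.
set A := \matrix_(i, j) _; set B := \matrix_(i, j) _ => eqAB.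
set V := Vandermonde q (\row_(t < q) tnth c t).
have uV : V \in unitmx := Vandermonde_enumeration_unit.
have /(can_inj (mulmxK uV))/(can_inj (mulKmx _))-> // :
    V^T *m A *m V = V^T *m B *m V.
  by apply/matrixP => i j; rewrite -!eval2_grid_mpoly.
by rewrite unitmx_tr.
Qed.

End FullEnumeration.

End Interpolation.

(** * The correspondence between LPPs and permutation polynomial tuples *)

Section Tuples.

Variables (F : finFieldType) (q : nat).

(** If two different entries agreed at [x], their common value would be a fixed point of
    [beta_i beta_j^-1]. *)
Lemma perm_poly_tuple_inj (beta : q.-tuple {perm F}) (x : F) :
  perm_poly_tuple beta -> injective (fun i => tnth beta i x).
Proof.
move=> ppt i j /= eq_ij; apply/eqP/idPn => /ppt/(_ (tnth beta j x)).
by rewrite permK eq_ij eqxx.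
Qed.

Hypothesis cardF : #|F| = q.

Lemma perm_poly_tuple_surj (beta : q.-tuple {perm F}) (x y : F) :
  perm_poly_tuple beta -> exists i, tnth beta i x = y.
Proof.
move=> ppt; have [|g _ gK] := inj_card_bij (perm_poly_tuple_inj (x := x) ppt).
  by rewrite card_ord cardF.
by exists (g y).
Qed.

Variable c : q.-tuple F.
Hypothesis uniq_c : uniq c.

Lemma tuple_of_LPP_uniq (f : {mpoly F[2]}) (beta gamma : q.-tuple {perm F}) :
  is_LPP f -> tuple_of_LPP c f beta -> tuple_of_LPP c f gamma -> beta = gamma.
Proof.
move=> [_ lppf] [_ fb] [_ fg]; apply: eq_from_tnth => i; apply/permP => x.
by have [_ /bij_inj] := lppf x; apply; rewrite fb fg.
Qed.

(** Every pair lies on the graph of some [beta_i], where both polynomials take the value [c_i]. *)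
Lemma LPP_tuple_inj (f g : {mpoly F[2]}) (beta : q.-tuple {perm F}) :
  is_LPP f -> is_LPP g -> tuple_of_LPP c f beta -> tuple_of_LPP c g beta ->
  f = g.
Proof.
move=> [redf _] [redg _] [ppt fb] [_ gb].
apply: (reduced_eval2_inj cardF uniq_c) => // x y.
by have [i <-] := perm_poly_tuple_surj x y ppt; rewrite fb gb.
Qed.

Lemma LPP_of_tuple (beta : q.-tuple {perm F}) : perm_poly_tuple beta ->
  exists f, is_LPP f /\ tuple_of_LPP c f beta.
Proof.
(* [phi (x, y)] is the index of the entry sending [x] to [y]; it becomes the subscript of the value
   at [(x, y)]. *)
move=> ppt; have [phi phiP] : exists phi : F * F -> 'I_q,
    forall u, tnth beta (phi u) u.1 = u.2.
  apply: (fin_all_exists (P := fun u i => tnth beta i u.1 = u.2)) => u.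
  exact: perm_poly_tuple_surj.
have [f redf fE] := reduced_interpolation cardF uniq_c
  (fun x y => tnth c (phi (x, y))).
exists f; split; last first.
  split=> // i x; rewrite fE; congr (tnth c _).
  by apply: (perm_poly_tuple_inj (x := x) ppt); rewrite phiP.
(* Equal values mean equal entries. In the first variable one permutation sends [x] and [y] to [z];
   in the second it sends [z] to both. *)
split=> // z; split; apply: injF_bij => x y; rewrite !fE;
  move/(tnth_enumeration_inj uniq_c) => eq_phi.
  apply: (@perm_inj _ (tnth beta (phi (x, z)))).
  by rewrite {2}eq_phi (phiP (x, z)) (phiP (y, z)).
by rewrite -[x](phiP (z, x)) eq_phi phiP.
Qed.

End Tuples.

(** * Tuples equivalent to [beta] whose entries form a group *)

Section EquivalentGroupTuples.

Local Open Scope group_scope.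

Variables (F : finFieldType) (q : nat) (beta : q.-tuple {perm F}).
Hypotheses (cardF : #|F| = q) (ppt : perm_poly_tuple beta).
Variable G : {group {perm F}}.
Hypothesis imG : [set tnth beta i | i : 'I_q] = G.

Lemma mem_tuple_group (i : 'I_q) : tnth beta i \in G.
Proof. by rewrite -imG imset_f. Qed.

(** Composed right to left, the entries are [lambda beta_i h lambda^-1] with [h = beta_i0^-1]; entry
    [i0] is the identity. *)
Definition conj_tuple (i0 : 'I_q) (lambda : {perm F}) : q.-tuple {perm F} :=
  [tuple ((tnth beta i0)^-1 * tnth beta i) ^ lambda | i < q].

(** In a quotient of two entries [h] cancels, leaving a conjugate of [beta_i beta_j^-1]. *)
Lemma conj_tuple_ppt i0 lambda : perm_poly_tuple (conj_tuple i0 lambda).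
Proof.
move=> i j ne x; rewrite !tnth_mktuple -conjVg /conjg invMg invgK.
rewrite !permM !permK; apply: contra (ppt ne (lambda^-1 x)) => /eqP eq_x.
by rewrite -{2}eq_x permK.
Qed.

Lemma conj_tuple_group i0 lambda :
  [set tnth (conj_tuple i0 lambda) i | i : 'I_q] = (G :^ lambda)%G.
Proof.
apply/setP => g; apply/imsetP/imsetP => [[i _ ->]|[h hG ->]].
  exists ((tnth beta i0)^-1 * tnth beta i); last by rewrite tnth_mktuple.
  by rewrite groupM ?groupV ?mem_tuple_group.
have /imsetP[i _ eq_i] : tnth beta i0 * h \in [set tnth beta i | i : 'I_q].
  by rewrite imG groupM ?mem_tuple_group.
by exists i; rewrite // tnth_mktuple -eq_i mulKg.
Qed.

Lemma conj_tuple_base o i0 (lambda : {perm F}) i : lambda (tnth beta i0 o) = o ->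
  tnth (conj_tuple i0 lambda) i o = lambda (tnth beta i o).
Proof.
move=> fix_o; rewrite tnth_mktuple /conjg !permM.
by rewrite -{1}fix_o !permK.
Qed.

(** The change from [lambda] to [mu] is the map sending [g o] to [g (sigma o)]. It commutes with
    [G], so both conjugate [G] in the same way, while [mu] is normalized at [o]. *)
Lemma equivalent_group_tuple (gamma : q.-tuple {perm F}) (o : F)
    (lambda sigma : {perm F}) (K : {group {perm F}}) :
  (forall i, tnth gamma i = sigma * tnth beta i * lambda) ->
  [set tnth gamma i | i : 'I_q] = K ->
  exists (mu : {perm F}) (i0 : 'I_q),
    mu (tnth beta i0 o) = o /\ gamma = conj_tuple i0 mu.
Proof.
move=> gammaE imK.
have [idx idxP] : exists idx : F -> 'I_q, forall x, tnth beta (idx x) o = x.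
  apply: (fin_all_exists (P := fun x i => tnth beta i o = x)) => x.
  exact: perm_poly_tuple_surj.
have idx_inj : injective idx by move=> x y e; rewrite -(idxP x) e idxP.
have idxK i : idx (tnth beta i o) = i.
  by apply: (perm_poly_tuple_inj (x := o) ppt); rewrite idxP.
(* [mu] sends [g o], for [g] in [G], to the image of [o] under the entry
   of [gamma] that comes from [g]. *)
have mu_inj : injective (fun x => lambda (tnth beta (idx x) (sigma o))).
  by move=> x y /perm_inj/(perm_poly_tuple_inj ppt)/idx_inj.
pose mu := perm mu_inj.
have muE i : mu (tnth beta i o) = tnth gamma i o.
  by rewrite permE idxK gammaE !permM.
(* Some entry of [gamma] is the identity, which determines [sigma]. *)
have /imsetP[i0 _ /esym gamma_i0] : 1 \in [set tnth gamma i | i : 'I_q].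
  by rewrite imK group1.
have sigmaE : sigma = lambda^-1 * (tnth beta i0)^-1.
  apply: (mulIg (tnth beta i0 * lambda)).
  by rewrite !mulgA -gammaE gamma_i0 mulgKV mulVg.
exists mu, i0; split; first by rewrite muE gamma_i0 perm1.
apply: eq_from_tnth => i; rewrite tnth_mktuple.
apply/(mulgI mu)/permP => x; rewrite mulKVg.
rewrite !permM -[x]idxP; set j := idx x.
(* By the formula for [sigma], [gamma_j] followed by [gamma_i] is [gamma_m]; the two sides are
   compared at [o]. *)
have /imsetP[m _ mE] : tnth beta j * (tnth beta i0)^-1 * tnth beta i
    \in [set tnth beta i | i : 'I_q].
  by rewrite imG !groupM ?groupV ?mem_tuple_group.
have -> : tnth beta i ((tnth beta i0)^-1 (tnth beta j o)) = tnth beta m o.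
  by rewrite -mE !permM.
rewrite !muE !gammaE -mE sigmaE !permM permK; congr (lambda _).
Qed.

End EquivalentGroupTuples.

(** * Counting the equivalent polynomials by the permutations of the field *)

Theorem proposition4p14 (l k q : nat) (hl : 2 <= l) (hk : k = 2 ^ l)
    (hq : q = 4 * k) (F : finFieldType) (hF : #|F| = q)
    (c : q.-tuple F) (hc : uniq c)
    (f2 : {mpoly F[2]}) (hf2 : group_poly_for c f2 (group_G k c))
    (beta : q.-tuple {perm F}) (hbeta : tuple_of_LPP c f2 beta) :
  has_cardinal
    (fun g : {mpoly F[2]} =>
       permutation_group_polynomial c g /\ LPP_equivalent c f2 g)
    (q`!).
Proof.
have [lpp2 [beta' hbeta' imG]] := hf2.
rewrite (tuple_of_LPP_uniq lpp2 hbeta' hbeta) {beta' hbeta'} in imG.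
have [ppt _] := hbeta; pose o : F := 0%R.
have [i0 i0P] : exists i0 : {perm F} -> 'I_q,
    forall lambda, tnth beta (i0 lambda) o = (lambda^-1)%g o.
  apply: (fin_all_exists (P := fun (lambda : {perm F}) i =>
    tnth beta i o = (lambda^-1)%g o)).
  by move=> lambda; apply: perm_poly_tuple_surj.
pose gamma lambda := conj_tuple beta (i0 lambda) lambda.
have gamma_o lambda i : tnth (gamma lambda) i o = lambda (tnth beta i o).
  by apply: conj_tuple_base; rewrite i0P permKV.
have [P PP] : exists P : {perm F} -> {mpoly F[2]}, forall lambda,
    is_LPP (P lambda) /\ tuple_of_LPP c (P lambda) (gamma lambda).
  apply: (fin_all_exists (P := fun lambda f =>
    is_LPP f /\ tuple_of_LPP c f (gamma lambda))).
  by move=> lambda; apply/LPP_of_tuple/conj_tuple_ppt.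
(* The tuple is recovered from the polynomial, and its values at [o] give [lambda] at all points
   [beta_i o], that is, everywhere. *)
have P_inj : injective P.
  move=> lambda mu eq_P; have [[lppl tupl] [_ tupm]] := (PP lambda, PP mu).
  rewrite -eq_P in tupm; have eq_gamma := tuple_of_LPP_uniq lppl tupl tupm.
  apply/permP => x; have [i <-] := perm_poly_tuple_surj hF o x ppt.
  by rewrite -!gamma_o eq_gamma.
exists [seq P lambda | lambda <- enum {perm F}]; split.
- by rewrite map_inj_uniq ?enum_uniq.
- rewrite size_map -cardE -hF -(cardsT F) -card_Sym; apply: eq_card => s.
  by rewrite !inE; apply/esym/subsetP => x; rewrite inE.
move=> g; split=> [/mapP[lambda _ ->]|].
  have [lppl tupl] := PP lambda; split.
    exists (group_G k c :^ lambda)%G; split=> //.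
    by exists (gamma lambda); last exact: conj_tuple_group.
  exists beta, (gamma lambda); split=> //.
  exists lambda, (lambda^-1 * (tnth beta (i0 lambda))^-1)%g => i x.
  by rewrite tnth_mktuple /conjg !permM.
case=> [[K [lppg [gam tupg imK]]] [beta' [gam' [tupb tupg' [lambda [sigma eqg]]]]]].
rewrite (tuple_of_LPP_uniq lppg tupg' tupg) in eqg.
rewrite (tuple_of_LPP_uniq lpp2 tupb hbeta) in eqg.
have gamE i : tnth gam i = (sigma * tnth beta i * lambda)%g.
  by apply/permP => x; rewrite !permM eqg.
have [mu [j [muj gam_mu]]] := equivalent_group_tuple hF ppt imG o gamE imK.
apply/mapP; exists mu; first by rewrite mem_enum.
have [lppm tupm] := PP mu; apply: (LPP_tuple_inj hF hc lppg lppm tupg).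
(* Both [j] and [i0 mu] index the entry sending [o] to [mu^-1 o], so they coincide. *)
have -> // : gam = gamma mu.
rewrite gam_mu /gamma; congr (conj_tuple beta _ mu).
by apply: (perm_poly_tuple_inj (x := o) ppt); rewrite /= i0P -{2}muj permK.
Qed.
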